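(* Let $\mathcal{C}$ be a triangulated category and let $(\mathcal{U},\mathcal{V})$ be a cotorsion pair in $\mathcal{C}$. (1) $\mathcal{V}\subseteq\mathcal{V}[1]$ if and only if $(\mathcal{U},\mathcal{V})=(\mathcal{T}^{\le-1},\mathcal{T}^{\ge1})$ for some $t$-structure $(\mathcal{T}^{\le0},\mathcal{T}^{\ge0})$ on $\mathcal{C}$. (2) $\mathcal{V}=\mathcal{U}$ if and only if $(\mathcal{U},\mathcal{V})=(\mathcal{T},\mathcal{T})$ for some cluster tilting subcategory $\mathcal{T}$ of $\mathcal{C}$.
   Context: $\mathcal{C}$ is a triangulated category with shift functor $[1]$; $\mathcal{C}(A,B)$ is the set of morphisms and $\mathrm{Ext}^{1}(A,B)=\mathcal{C}(A,B[1])$. Vanishing of $\mathcal{C}(\cdot,\cdot)$ or $\mathrm{Ext}^1(\cdot,\cdot)$ on full subcategories means vanishing for all of their objects. For a full subcategory $\mathcal{M}$, $\mathcal{M}[n]$ is the full subcategory of objects $M[n]$, $M\in\mathcal{M}$. A ''full additive thick subcategory'' is a full subcategory containing $0$ and closed under isomorphisms, finite direct sums and direct summands (it is not required to be closed under shifts or cones). A pair $(\mathcal{U},\mathcal{V})$ of full additive thick subcategories of $\mathcal{C}$ is a cotorsion pair if (1) $\mathrm{Ext}^1(\mathcal{U},\mathcal{V})=0$, and (2) for any $C\in\mathcal{C}$ there is a distinguished triangle $U\to C\to V[1]\to U[1]$ with $U\in\mathcal{U}$, $V\in\mathcal{V}$. A $t$-structure is a pair of full additive thick subcategories $(\mathcal{T}^{\le0},\mathcal{T}^{\ge0})$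 of $\mathcal{C}$ such that, with $\mathcal{T}^{\le n}:=\mathcal{T}^{\le0}[-n]$ and $\mathcal{T}^{\ge n}:=\mathcal{T}^{\ge0}[-n]$: $\mathcal{C}(\mathcal{T}^{\le0},\mathcal{T}^{\ge1})=0$; $\mathcal{T}^{\le0}\subseteq\mathcal{T}^{\le1}$ and $\mathcal{T}^{\ge1}\subseteq\mathcal{T}^{\ge0}$; and for any $C\in\mathcal{C}$ there is a distinguished triangle $X\to C\to Y\to X[1]$ with $X\in\mathcal{T}^{\le0}$, $Y\in\mathcal{T}^{\ge1}$. A full additive thick subcategory $\mathcal{T}$ is a cluster tilting subcategory if: $\mathcal{T}$ is functorially finite (i.e. every object of $\mathcal{C}$ admits a left and a right $\mathcal{T}$-approximation); $C\in\mathcal{T}$ if and only if $\mathrm{Ext}^1(C,\mathcal{T})=0$; and $C\in\mathcal{T}$ if and only if $\mathrm{Ext}^1(\mathcal{T},C)=0$. *)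

(* Defs.v *)
From mathcomp Require Import all_boot all_order all_algebra.
From mathcomp Require Import classical_sets.

Set Implicit Arguments.
Unset Strict Implicit.
Unset Printing Implicit Defensive.

Import GRing.Theory.
Local Open Scope classical_set_scope.
Local Open Scope ring_scope.

Declare Scope cat_scope.
Delimit Scope cat_scope with cat.
Local Open Scope cat_scope.

Reserved Notation "g ∘ f" (at level 40, left associativity).
Reserved Notation "X ≅ Y" (at level 70, no associativity).

Record preadditive_category := PreadditiveCategory {
  obj :> Type;
  hom : obj -> obj -> zmodType;
  idm : forall X, hom X X;
  comp : forall X Y Z, hom Y Z -> hom X Y -> hom X Z
    where "g ∘ f" := (comp g f);
  compA : forall W X Y Z (h : hom Y Z) (g : hom X Y) (f : hom W X),
    h ∘ (g ∘ f) = (h ∘ g) ∘ f;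
  comp1m : forall X Y (f : hom X Y), idm Y ∘ f = f;
  compm1 : forall X Y (f : hom X Y), f ∘ idm X = f;
  compDl : forall X Y Z (g g' : hom Y Z) (f : hom X Y),
    (g + g') ∘ f = g ∘ f + g' ∘ f;
  compDr : forall X Y Z (g : hom Y Z) (f f' : hom X Y),
    g ∘ (f + f') = g ∘ f + g ∘ f'
}.

Arguments hom {p} X Y.
Arguments idm {p} X.
Arguments comp {p X Y Z} g f.
Notation "g ∘ f" := (comp g f) : cat_scope.

Definition inverse_morphisms (C : preadditive_category) (X Y : C)
  (f : hom X Y) (g : hom Y X) : Prop := g ∘ f = idm X /\ f ∘ g = idm Y.

Definition is_iso (C : preadditive_category) (X Y : C) (f : hom X Y) : Prop :=
  exists g : hom Y X, inverse_morphisms f g.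

Definition isomorphic (C : preadditive_category) (X Y : C) : Prop :=
  exists f : hom X Y, is_iso f.
Notation "X ≅ Y" := (isomorphic X Y) : cat_scope.

(* Z is both terminal and initial: Hom-groups always contain 0. *)
Definition is_zero (C : preadditive_category) (Z : C) : Prop :=
  (forall X (f : hom X Z), f = 0) /\ (forall X (f : hom Z X), f = 0).

Definition is_biproduct (C : preadditive_category) (A B P : C) : Prop :=
  exists (i1 : hom A P) (i2 : hom B P) (p1 : hom P A) (p2 : hom P B),
    [/\ p1 ∘ i1 = idm A, p2 ∘ i2 = idm B, p1 ∘ i2 = 0, p2 ∘ i1 = 0
      & i1 ∘ p1 + i2 ∘ p2 = idm P].

Record additive_functor (C D : preadditive_category) := AdditiveFunctor {
  fobj :> C -> D;
  fmap : forall X Y : C, hom X Y -> hom (fobj X) (fobj Y);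
  fmap1 : forall X : C, fmap (idm X) = idm (fobj X);
  fmapM : forall (X Y Z : C) (g : hom Y Z) (f : hom X Y),
    fmap (g ∘ f) = fmap g ∘ fmap f;
  fmapD : forall (X Y : C) (f g : hom X Y), fmap (f + g) = fmap f + fmap g
}.

Arguments fmap {C D} F {X Y} f : rename.

Definition quasi_inverse (C D : preadditive_category)
    (F : additive_functor C D) (G : additive_functor D C) : Prop :=
  (exists eta : forall X : C, hom X (G (F X)),
     (forall X, is_iso (eta X)) /\
     (forall X Y (f : hom X Y), fmap G (fmap F f) ∘ eta X = eta Y ∘ f)) /\
  (exists eps : forall Y : D, hom (F (G Y)) Y,
     (forall Y, is_iso (eps Y)) /\
     (forall X Y (f : hom X Y), f ∘ eps X = eps Y ∘ fmap F (fmap G f))).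

(* The shift is an autoequivalence, with a chosen quasi-inverse [-1]; strict
   automorphisms are the special case where the unit and counit are identities.
   [dist f g h] means that X -f-> Y -g-> Z -h-> X[1] is distinguished.
   The axioms are TR1 (dist_iso, dist_id, dist_cone), TR2, TR3 and TR4. *)
Record triangulated_category := TriangulatedCategory {
  tcat :> preadditive_category;
  zero_exists : exists Z : tcat, is_zero Z;
  biproduct_exists : forall A B : tcat, exists P : tcat, is_biproduct A B P;
  shift : additive_functor tcat tcat;
  unshift : additive_functor tcat tcat;
  shiftK : quasi_inverse shift unshift;
  dist : forall X Y Z : tcat, hom X Y -> hom Y Z -> hom Z (shift X) -> Prop;
  dist_iso : forall (X Y Z X' Y' Z' : tcat)
      (f : hom X Y) (g : hom Y Z) (h : hom Z (shift X))
      (f' : hom X' Y') (g' : hom Y' Z') (h' : hom Z' (shift X'))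
      (a : hom X X') (b : hom Y Y') (c : hom Z Z'),
    is_iso a -> is_iso b -> is_iso c ->
    b ∘ f = f' ∘ a -> c ∘ g = g' ∘ b -> fmap shift a ∘ h = h' ∘ c ->
    dist f g h -> dist f' g' h';
  dist_id : forall X Z : tcat, is_zero Z ->
    dist (idm X) (0 : hom X Z) (0 : hom Z (shift X));
  dist_cone : forall (X Y : tcat) (f : hom X Y),
    exists (Z : tcat) (g : hom Y Z) (h : hom Z (shift X)), dist f g h;
  dist_rotate : forall (X Y Z : tcat)
      (f : hom X Y) (g : hom Y Z) (h : hom Z (shift X)),
    dist f g h <-> dist g h (- fmap shift f);
  dist_morphism : forall (X Y Z X' Y' Z' : tcat)
      (f : hom X Y) (g : hom Y Z) (h : hom Z (shift X))
      (f' : hom X' Y') (g' : hom Y' Z') (h' : hom Z' (shift X'))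
      (a : hom X X') (b : hom Y Y'),
    dist f g h -> dist f' g' h' -> b ∘ f = f' ∘ a ->
    exists c : hom Z Z', c ∘ g = g' ∘ b /\ fmap shift a ∘ h = h' ∘ c;
  dist_octahedron : forall (X Y Z X' Y' Z' : tcat)
      (u : hom X Y) (j : hom Y Z') (k : hom Z' (shift X))
      (v : hom Y Z) (l : hom Z X') (i : hom X' (shift Y))
      (m : hom Z Y') (n : hom Y' (shift X)),
    dist u j k -> dist v l i -> dist (v ∘ u) m n ->
    exists (f : hom Z' Y') (g : hom Y' X'),
      [/\ dist f g (fmap shift j ∘ i),
          f ∘ j = m ∘ v, n ∘ f = k, g ∘ m = l & i ∘ g = fmap shift u ∘ n]
}.

Arguments shift {t}.
Arguments unshift {t}.
Arguments dist {t X Y Z} f g h.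

Section Subcategories.
Variable C : triangulated_category.
(* A full subcategory is given by its set of objects. *)
Implicit Types (M N T U V : set C) (A B X Y : C).

Definition shiftz (X : C) (n : int) : C :=
  match n with
  | Posz k => iter k shift X
  | Negz k => iter k.+1 unshift X
  end.

(* M[n], closed under isomorphism because [1] need not be surjective on the
   nose on objects; for a strict automorphism [1] and an isomorphism-closed M
   this is exactly the set of the objects A[n], A in M. *)
Definition shift_sub M (n : int) : set C :=
  [set X | exists2 A, M A & X ≅ shiftz A n].

Definition Ext1 A B : zmodType := hom A (shift B).

Definition hom_vanish M N : Prop :=
  forall A B, M A -> N B -> forall f : hom A B, f = 0.

Definition Ext1_vanish M N : Prop :=
  forall A B, M A -> N B -> forall f : Ext1 A B, f = 0.

Record additive_thick M : Prop := AdditiveThick {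
  thick_zero : forall Z : C, is_zero Z -> M Z;
  thick_iso : forall A B, A ≅ B -> M A -> M B;
  thick_sum : forall A B P : C, is_biproduct A B P -> M A -> M B -> M P;
  thick_summand : forall A B P : C, is_biproduct A B P -> M P -> M A
}.

Record cotorsion_pair U V : Prop := CotorsionPair {
  cotorsion_thickl : additive_thick U;
  cotorsion_thickr : additive_thick V;
  cotorsion_Ext1 : Ext1_vanish U V;
  cotorsion_triangle : forall X : C, exists A B : C,
    [/\ U A, V B &
        exists (f : hom A X) (g : hom X (shift B))
               (h : hom (shift B) (shift A)), dist f g h]
}.

(* [tshift T0 n] is T^{<= n} or T^{>= n}, when T0 is T^{<= 0} or T^{>= 0}. *)
Definition tshift T (n : int) : set C := shift_sub T (- n).

Record t_structure (Tle0 Tge0 : set C) : Prop := TStructure {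
  tstr_thickl : additive_thick Tle0;
  tstr_thickr : additive_thick Tge0;
  tstr_hom : hom_vanish Tle0 (tshift Tge0 1);
  tstr_le : Tle0 `<=` tshift Tle0 1;
  tstr_ge : tshift Tge0 1 `<=` Tge0;
  tstr_triangle : forall Z : C, exists X Y : C,
    [/\ Tle0 X, tshift Tge0 1 Y &
        exists (f : hom X Z) (g : hom Z Y) (h : hom Y (shift X)), dist f g h]
}.

Definition right_approximation T X A (f : hom A X) : Prop :=
  T A /\ forall B (g : hom B X), T B -> exists g' : hom B A, g = f ∘ g'.

Definition left_approximation T X A (f : hom X A) : Prop :=
  T A /\ forall B (g : hom X B), T B -> exists g' : hom A B, g = g' ∘ f.

Definition functorially_finite T : Prop :=
  forall X, (exists A (f : hom X A), left_approximation T f) /\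
            (exists A (f : hom A X), right_approximation T f).

Record cluster_tilting T : Prop := ClusterTilting {
  ct_thick : additive_thick T;
  ct_functorially_finite : functorially_finite T;
  ct_Ext1l : forall X, T X <-> Ext1_vanish [set X] T;
  ct_Ext1r : forall X, T X <-> Ext1_vanish T [set X]
}.

End Subcategories.

(* Main.v *)
Require Import Defs.
From mathcomp Require Import all_boot all_order all_algebra.
From mathcomp Require Import classical_sets.

(** The triangle of a cotorsion pair (U, V) can be read in two ways. For an
    object C it is U0 -> C -> V0[1] -> U0[1], which presents C from the left by
    U. Applied to C[1] and shifted back, it becomes C -> V0 -> U0 -> C[1], which
    presents C from the right by V ([cotorsion_coresolution]). Obtaining the
    second form rests on two facts: the shift is full and faithful, so the map
    C[1] -> V0[1] is the shift of a map C -> V0; and a cone is unique up to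
    isomorphism ([dist_cone_unique]), so the cone of C -> V0 is U0.

    If the last map of the first triangle out of C vanishes, C is a retract of
    U0; if the connecting map U0 -> C[1] of the second vanishes, C is a retract
    of V0. As retracts are direct summands in a triangulated category
    ([retract_biproduct]), U and V determine each other: U is the left and V
    the right orthogonal for Ext^1 ([cotorsion_leftE], [cotorsion_rightE]).

    A t-structure with U = T^{<=-1} and V = T^{>=1} has to be
    T^{<=0} = U[-1] and T^{>=0} = V[1]. Its orthogonality is that of the
    cotorsion pair, and its triangles are the second ones rotated. The
    inclusion V in V[1] is the required
    T^{>=1} in T^{>=0}, and by orthogonality it also yields U[1] in U, that is,
    T^{<=0} in T^{<=1}.

    When U = V, the two orthogonality statements are the two Ext^1 conditions
    for a cluster tilting subcategory, and the maps U0 -> C and C -> V0 of the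
    two triangles are the approximations. *)

(* The algebra library also defines a constant [hom]; importing the definitions
   again makes [hom] denote the groups of morphisms. *)
Import Defs GRing.Theory.
Local Open Scope classical_set_scope.
Local Open Scope ring_scope.
Local Open Scope cat_scope.

Set Implicit Arguments.
Unset Strict Implicit.

(** * Preadditive categories *)

Section Preadditive.
Variable C : preadditive_category.
Implicit Types X Y Z : C.

Lemma comp0m X Y Z (f : hom X Y) : (0 : hom Y Z) ∘ f = 0.
Proof. by apply: (addrI ((0 : hom Y Z) ∘ f)); rewrite -compDl !addr0. Qed.

Lemma compm0 X Y Z (g : hom Y Z) : g ∘ (0 : hom X Y) = 0.
Proof. by apply: (addrI (g ∘ (0 : hom X Y))); rewrite -compDr !addr0. Qed.

Lemma compNm X Y Z (g : hom Y Z) (f : hom X Y) : (- g) ∘ f = - (g ∘ f).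
Proof. by apply: (addrI (g ∘ f)); rewrite -compDl !subrr comp0m. Qed.

Lemma compmN X Y Z (g : hom Y Z) (f : hom X Y) : g ∘ (- f) = - (g ∘ f).
Proof. by apply: (addrI (g ∘ f)); rewrite -compDr !subrr compm0. Qed.

Lemma compBl X Y Z (g g' : hom Y Z) (f : hom X Y) :
  (g - g') ∘ f = g ∘ f - g' ∘ f.
Proof. by rewrite compDl compNm. Qed.

Lemma compBr X Y Z (g : hom Y Z) (f f' : hom X Y) :
  g ∘ (f - f') = g ∘ f - g ∘ f'.
Proof. by rewrite compDr compmN. Qed.

Lemma is_iso_idm X : is_iso (idm X).
Proof. by exists (idm X); split; rewrite comp1m. Qed.

Lemma is_iso_opp X Y (f : hom X Y) : is_iso f -> is_iso (- f).
Proof.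
by case=> g [gf fg]; exists (- g); split; rewrite compNm compmN opprK.
Qed.

Lemma isomorphic_refl X : X ≅ X.
Proof. by exists (idm X); exact: is_iso_idm. Qed.

Lemma isomorphic_sym X Y : X ≅ Y -> Y ≅ X.
Proof. by case=> f [g [gf fg]]; exists g, f; split. Qed.

Lemma isomorphic_trans X Y Z : X ≅ Y -> Y ≅ Z -> X ≅ Z.
Proof.
case=> f [g [gf fg]] [f' [g' [gf' fg']]]; exists (f' ∘ f), (g ∘ g'); split.
- by rewrite -compA (compA g') gf' comp1m.
- by rewrite -compA (compA f) fg comp1m.
Qed.

Lemma is_iso_of_sides X Y (f : hom X Y) (g g' : hom Y X) :
  g ∘ f = idm X -> f ∘ g' = idm Y -> is_iso f.
Proof.
move=> gf fg'; have e : g = g' by rewrite -(compm1 g) -fg' compA gf comp1m.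
by exists g; split=> //; rewrite e.
Qed.

(** With n = e - 1 and n^2 = 0, the inverse of 1 + n is 1 - n. *)
Lemma is_iso_unipotent X (e : hom X X) :
  (e - idm X) ∘ (e - idm X) = 0 -> is_iso e.
Proof.
suff iso1n n : n ∘ n = 0 -> is_iso (idm X + n).
  by move/iso1n; rewrite addrC subrK.
move=> n2; exists (idm X - n); split.
- by rewrite compBl !compDr !compm1 comp1m n2 addr0 addrK.
- by rewrite compDl !compBr !compm1 comp1m n2 subr0 subrK.
Qed.

(** In this form, being a zero object is visibly preserved by additive
    functors. *)
Lemma is_zeroP X : is_zero X <-> idm X = 0.
Proof.
split=> [[zX _]|X0]; first exact: zX.
by split=> Y f; [rewrite -(comp1m f) X0 comp0m | rewrite -(compm1 f) X0 compm0].
Qed.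

End Preadditive.

(** * Additive functors *)

Section AdditiveFunctor.
Variables (C D : preadditive_category) (F : additive_functor C D).

Lemma fmap0 (X Y : C) : fmap F (0 : hom X Y) = 0.
Proof. by apply: (addrI (fmap F (0 : hom X Y))); rewrite -fmapD !addr0. Qed.

Lemma fmapN (X Y : C) (f : hom X Y) : fmap F (- f) = - fmap F f.
Proof. by apply: (addrI (fmap F f)); rewrite -fmapD !subrr fmap0. Qed.

Lemma fmap_is_zero (X : C) : is_zero X -> is_zero (F X).
Proof. by move=> /is_zeroP X0; apply/is_zeroP; rewrite -fmap1 X0 fmap0. Qed.

Lemma fmap_isomorphic (X Y : C) : X ≅ Y -> F X ≅ F Y.
Proof.
by case=> f [g [gf fg]]; exists (fmap F f), (fmap F g); split;
  rewrite -fmapM ?gf ?fg fmap1.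
Qed.

Lemma fmap_is_biproduct (A B P : C) :
  is_biproduct A B P -> is_biproduct (F A) (F B) (F P).
Proof.
case=> i1 [i2 [p1 [p2 [h1 h2 h3 h4 h5]]]].
exists (fmap F i1), (fmap F i2), (fmap F p1), (fmap F p2).
by split; rewrite -!fmapM -?fmapD ?h1 ?h2 ?h3 ?h4 ?h5 ?fmap0 ?fmap1.
Qed.

End AdditiveFunctor.

(** * The shift as an equivalence *)

Section Shift.
Variable C : triangulated_category.
Implicit Types X Y Z : C.

Lemma isomorphic_unshift_shift X : X ≅ unshift (shift X).
Proof. by case: (shiftK C) => [[eta [iso_eta _]] _]; exists (eta X). Qed.

Lemma isomorphic_shift_unshift X : X ≅ shift (unshift X).
Proof.
by case: (shiftK C) => [_ [eps [iso_eps _]]]; apply: isomorphic_sym; exists (eps X).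
Qed.

Lemma shift_faithful X Y (f g : hom X Y) :
  fmap shift f = fmap shift g -> f = g.
Proof.
case: (shiftK C) => [[eta [iso_eta nat_eta]] _] fg.
have [k [ke _]] := iso_eta Y.
by rewrite -(comp1m f) -(comp1m g) -ke -!compA -!nat_eta fg.
Qed.

Lemma unshift_faithful X Y (f g : hom X Y) :
  fmap unshift f = fmap unshift g -> f = g.
Proof.
case: (shiftK C) => [_ [eps [iso_eps nat_eps]]] fg.
have [k [_ ek]] := iso_eps X.
by rewrite -(compm1 f) -(compm1 g) -ek !compA !nat_eps fg.
Qed.

Lemma shift_full X Y (h : hom (shift X) (shift Y)) :
  exists f : hom X Y, h = fmap shift f.
Proof.
case: (shiftK C) => [[eta [iso_eta nat_eta]] _].
have [k [ke ek]] := iso_eta Y; have [l [le el]] := iso_eta X.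
(* The transport of h[-1] along the unit; its image under [1] equals h because
   both become equal under [-1], which is faithful. *)
exists (k ∘ (fmap unshift h ∘ eta X)); apply: unshift_faithful.
set f := k ∘ _.
by rewrite -(compm1 (fmap unshift (fmap shift f))) -el compA nat_eta /f
  (compA (eta Y)) ek comp1m -compA el compm1.
Qed.

Lemma shift_reflects_isomorphic X Y : shift X ≅ shift Y -> X ≅ Y.
Proof.
move/(fmap_isomorphic (unshift (t := C))) => h.
apply: isomorphic_trans (isomorphic_unshift_shift X) _.
by apply: isomorphic_trans h _; apply/isomorphic_sym/isomorphic_unshift_shift.
Qed.

End Shift.

(** * Exactness and uniqueness of cones *)

Section Triangles.
Variable C : triangulated_category.
Implicit Types W X Y Z : C.

Lemma dist_rotate1 {X Y Z} {f : hom X Y} {g : hom Y Z}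
    {h : hom Z (shift X)} : dist f g h -> dist g h (- fmap shift f).
Proof. by move/dist_rotate. Qed.

(** Exactness of Hom(-, W) in the middle: since k kills f, it extends to a
    morphism from the given triangle to 0 -> W = W -> 0[1], whose third
    component is the factorization. *)
Lemma dist_factor_right {X Y Z W} {f : hom X Y} {g : hom Y Z}
    {h : hom Z (shift X)} (k : hom Y W) :
  dist f g h -> k ∘ f = 0 -> exists l : hom Z W, k = l ∘ g.
Proof.
move=> D kf; have [O Oz] := zero_exists C.
have T : dist (0 : hom O W) (idm W) (0 : hom W (shift O)).
  apply/dist_rotate; rewrite fmap0 oppr0.
  apply: (dist_iso (is_iso_idm W) (is_iso_idm W) (is_iso_idm _)) (dist_id _ _);
    rewrite ?comp1m ?compm1 ?comp0m ?compm0 //.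
  exact: fmap_is_zero.
have [l [lg _]] := dist_morphism (a := 0 : hom X O) D T
  (etrans kf (esym (comp0m _ _))).
by exists l; rewrite lg comp1m.
Qed.

Lemma dist_factor_right3 {X Y Z W} {f : hom X Y} {g : hom Y Z}
    {h : hom Z (shift X)} (k : hom Z W) :
  dist f g h -> k ∘ g = 0 -> exists l : hom (shift X) W, k = l ∘ h.
Proof. by move/dist_rotate; exact: dist_factor_right. Qed.

(** Exactness of Hom(W, -) in the middle: k is the first component of a
    morphism from the once rotated triangle W -> 0 -> W[1] = W[1], whose third
    component is minus the shift of the factorization. *)
Lemma dist_factor_left {X Y Z W} {f : hom X Y} {g : hom Y Z}
    {h : hom Z (shift X)} (k : hom W Y) :
  dist f g h -> g ∘ k = 0 -> exists l : hom W X, k = f ∘ l.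
Proof.
move=> D gk; have [O Oz] := zero_exists C.
have T : dist (0 : hom W O) (0 : hom O (shift W)) (- fmap shift (idm W)).
  by apply: dist_rotate1; exact: dist_id.
have D' := dist_rotate1 D.
have [l [_]] := dist_morphism (a := k) (b := 0 : hom O Z) T D'
  (etrans (comp0m _ _) (esym gk)).
have [m ->] := shift_full l.
rewrite fmap1 compmN compm1 compNm -fmapM => /oppr_inj/shift_faithful ->.
by exists m.
Qed.

Lemma dist_factor_left3 {X Y Z W} {f : hom X Y} {g : hom Y Z}
    {h : hom Z (shift X)} (k : hom W Z) :
  dist f g h -> h ∘ k = 0 -> exists l : hom W Y, k = g ∘ l.
Proof. by move/dist_rotate; exact: dist_factor_left. Qed.

(** Comparison with the triangle X = X -> 0 -> X[1] makes g f factor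
    through 0. *)
Lemma dist_comp21 {X Y Z} {f : hom X Y} {g : hom Y Z}
    {h : hom Z (shift X)} : dist f g h -> g ∘ f = 0.
Proof.
move=> D; have [O Oz] := zero_exists C.
have [c [cg _]] := dist_morphism (a := idm X) (b := f) (dist_id X Oz) D
  (erefl _).
by rewrite -cg compm0.
Qed.

(** The difference e - 1 factors through h by exactness, and h (e - 1) = 0,
    so (e - 1)^2 = 0. *)
Lemma dist_endo_iso {X Y Z} {f : hom X Y} {g : hom Y Z}
    {h : hom Z (shift X)} (e : hom Z Z) :
  dist f g h -> e ∘ g = g -> h ∘ e = h -> is_iso e.
Proof.
move=> D eg he; apply: is_iso_unipotent.
have [|l el] := dist_factor_right3 (k := e - idm Z) D.
  by rewrite compBl eg comp1m subrr.
by rewrite {1}el -compA compBr he compm1 subrr compm0.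
Qed.

(** The axiom on morphisms of triangles gives c : Z -> Z' and c' : Z' -> Z
    that need not be inverse to each other; but c' c and c c' are
    endomorphisms fixing the rest of their triangles, hence invertible. *)
Lemma dist_cone_unique {X Y X' Y' Z Z'} {f : hom X Y} {g : hom Y Z}
    {h : hom Z (shift X)} {f' : hom X' Y'} {g' : hom Y' Z'}
    {h' : hom Z' (shift X')} (a : hom X X') (b : hom Y Y') :
  dist f g h -> dist f' g' h' -> is_iso a -> is_iso b -> b ∘ f = f' ∘ a ->
  Z ≅ Z'.
Proof.
move=> D D' [a' [a'a aa']] [b' [b'b bb']] sq.
have sq' : b' ∘ f' = f ∘ a'.
  by rewrite -(compm1 f') -aa' (compA f') -sq !compA b'b comp1m.
have [c [cg hc]] := dist_morphism D D' sq.
have [c' [cg' hc']] := dist_morphism D' D sq'.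
have [u [uc _]] : is_iso (c' ∘ c).
  apply: (dist_endo_iso D).
  - by rewrite -compA cg compA cg' -compA b'b compm1.
  - by rewrite compA -hc' -compA -hc compA -fmapM a'a fmap1 comp1m.
have [v [_ cv]] : is_iso (c ∘ c').
  apply: (dist_endo_iso D').
  - by rewrite -compA cg' compA cg -compA bb' compm1.
  - by rewrite compA -hc -compA -hc' compA -fmapM aa' fmap1 comp1m.
exists c; apply: (is_iso_of_sides (g := u ∘ c') (g' := c' ∘ v)).
  by rewrite -compA.
by rewrite compA.
Qed.

(** A triangle that starts at Y may be rotated backwards once its third
    object W is replaced by the shift of W[-1]; fullness turns W[-1][1] -> Y[1]
    into minus the shift of the new first map. *)
Lemma dist_fibre {Y Z W} {g : hom Y Z} {h : hom Z W}
    {k : hom W (shift Y)} :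
  dist g h k -> exists (X : C) (f : hom X Y) (l : hom Z (shift X)),
    shift X ≅ W /\ dist f g l.
Proof.
move=> D; have [s [t [ts st]]] := isomorphic_shift_unshift W.
have [f ef] := shift_full (- (k ∘ t)).
exists (unshift W), f, (s ∘ h); split; first by exists t, s; split.
apply/dist_rotate; rewrite -ef opprK.
apply: (dist_iso (is_iso_idm Y) (is_iso_idm Z) (c := s) _ _ _ _ D).
- by exists t; split.
- by rewrite comp1m compm1.
- by rewrite compm1.
- by rewrite fmap1 comp1m -compA ts compm1.
Qed.

(** The complement of a retract X of A is the cone Y of s : X -> A. As s is a
    split monomorphism, the connecting map Y -> X[1] vanishes, so A -> Y is a
    split epimorphism. *)
Lemma retract_biproduct {X A} (s : hom X A) (f : hom A X) :
  f ∘ s = idm X -> exists Y : C, is_biproduct X Y A.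
Proof.
move=> fs; have [Y [q [r D]]] := dist_cone s.
have r0 : r = 0.
  have := dist_comp21 (dist_rotate1 (dist_rotate1 D)).
  rewrite compNm => /eqP; rewrite oppr_eq0 => /eqP sr.
  by rewrite -(comp1m r) -fmap1 -fs fmapM -compA sr compm0.
have [|t qt] := dist_factor_left3 (k := idm Y) D; first by rewrite r0 comp0m.
have qs := dist_comp21 D.
(* Correcting the section t of q so that f kills it. *)
pose t' := t - s ∘ (f ∘ t).
have qt' : q ∘ t' = idm Y by rewrite compBr -qt compA qs comp0m subr0.
have ft' : f ∘ t' = 0 by rewrite compBr compA fs comp1m subrr.
exists Y, s, t', f, q; split=> //.
(* The defect d of the biproduct identity kills s, so it factors as k q; it
   also kills the section t' of q, so k = 0. *)
pose d := idm A - (s ∘ f + t' ∘ q).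
have [|k dk] := dist_factor_right (k := d) D.
  by rewrite compBl compDl comp1m -!compA fs qs compm0 compm1 addr0 subrr.
have dt : d ∘ t' = 0.
  by rewrite compBl compDl comp1m -!compA ft' qt' compm0 compm1 add0r subrr.
have k0 : k = 0 by rewrite -(compm1 k) -qt' compA -dk.
by apply/esym/eqP; rewrite -subr_eq0 -/d dk k0 comp0m.
Qed.

End Triangles.

(** * Shifts of thick subcategories *)

Section Subcategories.
Variable C : triangulated_category.
Implicit Types (M U V : set C).

Lemma thick_retract M (X A : C) (s : hom X A) (f : hom A X) :
  additive_thick M -> f ∘ s = idm X -> M A -> M X.
Proof.
move=> thM fs MA; have [Y bi] := retract_biproduct fs.
exact: thick_summand thM _ _ _ bi MA.
Qed.

Lemma thick_preimage M (F : additive_functor C C) :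
  additive_thick M -> additive_thick (F @^-1` M).
Proof.
move=> thM; split=> /=.
- by move=> Z Zz; apply: (thick_zero thM); exact: fmap_is_zero.
- by move=> A B AB; apply: (thick_iso thM); exact: fmap_isomorphic.
- move=> A B P bi; apply: (thick_sum thM); exact: fmap_is_biproduct bi.
- by move=> A B P bi; apply: (thick_summand thM); exact: fmap_is_biproduct bi.
Qed.

(** Preimages under the shift are easier to handle than the closure under
    isomorphism of the image: additive functors preserve all the structure
    that thickness refers to. *)
Lemma shift_subN1 M : additive_thick M -> shift_sub M (-1) = shift @^-1` M.
Proof.
move=> thM; apply/seteqP; split=> X /=.
  case=> A MA XA; apply: (thick_iso thM) MA; apply: isomorphic_sym.
  apply: isomorphic_trans (fmap_isomorphic _ XA) _.
  by apply/isomorphic_sym/isomorphic_shift_unshift.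
by move=> MX; exists (shift X) => //; exact: isomorphic_unshift_shift.
Qed.

Lemma shift_sub1 M : additive_thick M -> shift_sub M 1 = unshift @^-1` M.
Proof.
move=> thM; apply/seteqP; split=> X /=.
  case=> A MA XA; apply: (thick_iso thM) MA; apply: isomorphic_sym.
  apply: isomorphic_trans (fmap_isomorphic _ XA) _.
  by apply/isomorphic_sym/isomorphic_unshift_shift.
by move=> MX; exists (unshift X) => //; exact: isomorphic_shift_unshift.
Qed.

Lemma shift_sub1N1 M : additive_thick M -> shift_sub (shift_sub M 1) (-1) = M.
Proof.
move=> thM; rewrite shift_subN1 shift_sub1 //; last exact: thick_preimage.
apply/seteqP; split=> X /=; apply: (thick_iso thM).
  by apply/isomorphic_sym/isomorphic_unshift_shift.
exact: isomorphic_unshift_shift.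
Qed.

Lemma shift_subN11 M : additive_thick M -> shift_sub (shift_sub M (-1)) 1 = M.
Proof.
move=> thM; rewrite shift_sub1 shift_subN1 //; last exact: thick_preimage.
apply/seteqP; split=> X /=; apply: (thick_iso thM).
  by apply/isomorphic_sym/isomorphic_shift_unshift.
exact: isomorphic_shift_unshift.
Qed.

End Subcategories.

(** * Cotorsion pairs *)

Section CotorsionPair.
Variables (C : triangulated_category) (U V : set C).
Hypothesis hUV : cotorsion_pair U V.

(** The cotorsion triangle A -> Z[1] -> B[1] -> A[1] shifted back. Its middle
    map is w[1] for some w : Z -> B, and the cone W of w satisfies W[1] = A[1]
    up to isomorphism, because both are cones of w[1] up to sign. *)
Lemma cotorsion_coresolution (Z : C) : exists B W : C,
  [/\ V B, U W &
      exists (f : hom Z B) (g : hom B W) (h : hom W (shift Z)), dist f g h].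
Proof.
have [A [B [UA VB [f [g [h D]]]]]] := cotorsion_triangle hUV (shift Z).
have [w ew] := shift_full g.
have [W [p [q E]]] := dist_cone w.
exists B, W; split=> //; last by exists w, p, q.
(* Three rotations shift the triangle and change the signs of its maps; the
   sign of the first map is absorbed by the isomorphism -1 of B[1]. *)
have E3 := dist_rotate1 (dist_rotate1 (dist_rotate1 E)).
have D1 := dist_rotate1 D.
apply: (thick_iso (cotorsion_thickl hUV)) UA; apply: isomorphic_sym.
apply: shift_reflects_isomorphic.
apply: (dist_cone_unique E3 D1 (is_iso_idm _) (is_iso_opp (is_iso_idm _))).
by rewrite compNm comp1m opprK compm1 ew.
Qed.

(** For X orthogonal to V the map X -> B[1] of its triangle is zero, so X is
    a retract of A in U. *)
Lemma cotorsion_leftE (X : C) : U X <-> Ext1_vanish [set X] V.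
Proof.
split=> [UX A B -> VB f|XV]; first exact: (cotorsion_Ext1 hUV UX VB).
have [A [B [UA VB [f [g [h D]]]]]] := cotorsion_triangle hUV X.
have g0 : g = 0 by exact: XV.
have [|s fs] := dist_factor_left (k := idm X) D; first by rewrite g0 comp0m.
exact: (thick_retract (cotorsion_thickl hUV) (esym fs) UA).
Qed.

(** For X orthogonal to U the map W -> X[1] of its coresolution is zero, so
    X is a retract of B in V. *)
Lemma cotorsion_rightE (X : C) : V X <-> Ext1_vanish U [set X].
Proof.
split=> [VX A B UA -> f|UX]; first exact: (cotorsion_Ext1 hUV UA VX).
have [B [W [VB UW [f [g [h D]]]]]] := cotorsion_coresolution X.
have h0 : h = 0 by exact: UX UW (erefl X) h.
have [|k] := dist_factor_right3 (k := idm (shift X)) (dist_rotate1 D).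
  by rewrite comp1m.
have [s ->] := shift_full k.
rewrite compmN -fmapM -fmapN -fmap1 -compNm => /shift_faithful/esym sf.
exact: (thick_retract (cotorsion_thickr hUV) sf VB).
Qed.

(** A map X[1] -> B[1] with B in V is the shift of a map X -> B, and B lies
    in V[1], so that map belongs to a vanishing Ext^1. Hence X[1] is orthogonal
    to V. *)
Lemma cotorsion_shift_closed (X : C) :
  V `<=` shift_sub V 1 -> U X -> U (shift X).
Proof.
move=> VV1 UX; apply/cotorsion_leftE => _ B -> VB f.
have [g ->] := shift_full f.
have [A VA [s [t [ts st]]]] := VV1 B VB.
have sg0 : s ∘ g = 0 := cotorsion_Ext1 hUV UX VA (s ∘ g).
by rewrite -(comp1m g) -ts -compA sg0 compm0 fmap0.
Qed.

Lemma cotorsion_t_structure :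
  V `<=` shift_sub V 1 -> t_structure (shift_sub U (-1)) (shift_sub V 1).
Proof.
have thU := cotorsion_thickl hUV; have thV := cotorsion_thickr hUV.
have thU' := thick_preimage shift thU; have thV' := thick_preimage unshift thV.
have VE : tshift (shift_sub V 1) 1 = V by exact: shift_sub1N1.
move=> VV1; split; rewrite ?VE.
- by rewrite shift_subN1.
- by rewrite shift_sub1.
- rewrite shift_subN1 // => A B UA VB f; apply: shift_faithful.
  by rewrite fmap0; exact: (cotorsion_Ext1 hUV UA VB).
- rewrite /tshift shift_subN1 // shift_subN1 // => X UX.
  exact: cotorsion_shift_closed VV1 UX.
- exact: VV1.
- move=> Z; have [B [W [VB UW [f [g [h D]]]]]] := cotorsion_coresolution Z.
  have [X [e [l [XW D']]]] := dist_fibre D.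
  exists X, B; split=> //; last by exists e, f, l.
  by rewrite shift_subN1 //; apply: (thick_iso thU) UW; exact: isomorphic_sym.
Qed.

Lemma cotorsion_right_approximation (X : C) :
  exists (A : C) (f : hom A X), right_approximation U f.
Proof.
have [A [B [UA VB [f [g [h D]]]]]] := cotorsion_triangle hUV X.
exists A, f; split=> // A' k UA'; apply: dist_factor_left D _.
exact: (cotorsion_Ext1 hUV UA' VB).
Qed.

(** A map k : X -> B' with B' in V extends along X -> B since its obstruction
    W -> X[1] -> B'[1] lies in Ext^1(U, V). *)
Lemma cotorsion_left_approximation (X : C) :
  exists (B : C) (f : hom X B), left_approximation V f.
Proof.
have [B [W [VB UW [f [g [h D]]]]]] := cotorsion_coresolution X.
exists B, f; split=> // B' k VB'.
have kh : fmap shift k ∘ h = 0 := cotorsion_Ext1 hUV UW VB' _.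
have [l] := dist_factor_right3 (k := fmap shift k) (dist_rotate1 D) kh.
have [m ->] := shift_full l.
rewrite compmN -fmapM -fmapN -compNm => /shift_faithful ->.
by exists (- m).
Qed.

End CotorsionPair.

(** * t-structures and cluster tilting subcategories *)

Unset Implicit Arguments.
Set Strict Implicit.

Theorem proposition2p6 (C : triangulated_category) (U V : set C)
    (hUV : cotorsion_pair U V) :
  (V `<=` shift_sub V 1 <->
     exists Tle0 Tge0 : set C,
       t_structure Tle0 Tge0 /\ (U, V) = (tshift Tle0 (-1), tshift Tge0 1)) /\
  (V = U <->
     exists T : set C, cluster_tilting T /\ (U, V) = (T, T)).
Proof.
have thU := cotorsion_thickl hUV; have thV := cotorsion_thickr hUV.
split; split.
- move=> VV1; exists (shift_sub U (-1)), (shift_sub V 1); split.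
    exact: cotorsion_t_structure.
  by congr (_, _); apply: esym; [exact: shift_subN11 | exact: shift_sub1N1].
- case=> Tle0 [Tge0 [t [_ VE]]] X VX.
  exists (unshift X); last exact: isomorphic_shift_unshift.
  rewrite VE; exists X; last exact: isomorphic_refl.
  by apply: (tstr_ge t); rewrite -VE.
- move=> VU; exists U; split; last by rewrite VU.
  split=> //.
  + move=> X; split; last exact: (cotorsion_right_approximation hUV).
    by rewrite -VU; exact: (cotorsion_left_approximation hUV).
  + by move=> X; rewrite -{2}VU; exact: (cotorsion_leftE hUV).
  + by move=> X; rewrite -{1}VU; exact: (cotorsion_rightE hUV).
- by case=> T [_ [-> ->]].
Qed.
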